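(* Consider the planar system, depending on the parameter $\mu=(\mu_1,\mu_2)\in\mathbb{R}^2$ with $|\mu|$ sufficiently small, $$\frac{d\xi_1}{dt}=\xi_1\left(\mu_1-\theta(\mu)\xi_1+\gamma(\mu)\xi_2-M(\mu)\xi_1\xi_2+N(\mu)\xi_1^2\right),\qquad \frac{d\xi_2}{dt}=\xi_2\left(\mu_2-\delta(\mu)\xi_1+\xi_2+S(\mu)\xi_1^2+P(\mu)\xi_2^2\right),$$ where $\theta,\gamma,\delta,M,N,S,P$ are smooth functions of $\mu$ near $0$; write $\theta=\theta(0)$, $\gamma=\gamma(0)$, $\delta=\delta(0)$, and let $\gamma<0$. Assume $\theta\delta\neq 0$ and $\theta-\gamma\delta\neq 0$. Then the curve $$T_1=\left\{(\mu_1,\mu_2)\in\mathbb{R}^2 \;:\; \mu_2=\frac{\delta}{\theta}\mu_1+O(\mu_1^2),\ \frac{\mu_1}{\theta}>0\right\},$$ defined by the vanishing of the second coordinate of the equilibrium $E_3$, is a transcritical bifurcation curve for all $|\mu|$ sufficiently small.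
   Context: Here $|\mu|=\sqrt{\mu_1^2+\mu_2^2}$. The system is studied only in the closed first quadrant $Q1=\{\xi_1\ge 0,\ \xi_2\ge 0\}$, near the origin. For $|\mu|$ small, $E_1=(\xi_1,0)$ is the equilibrium near the origin determined by $\mu_1-\theta\xi_1+N\xi_1^2=0$, with $\xi_1=\frac{1}{\theta}\mu_1+O(\mu_1^2)$. When $\theta-\gamma\delta\ne 0$, $E_3=(\xi_1,\xi_2)$ is the unique solution near the origin, given by the Implicit Function Theorem, of $$\mu_1-\theta\xi_1+\gamma\xi_2-M\xi_1\xi_2+N\xi_1^2=0,\qquad \mu_2-\delta\xi_1+\xi_2+S\xi_1^2+P\xi_2^2=0$$ (coefficients evaluated at $\mu$). Its coordinates are $$\xi_1=\tfrac{\mu_1}{\theta-\gamma\delta}(1+O(|\mu|))-\tfrac{\gamma\mu_2}{\theta-\gamma\delta}(1+O(|\mu|)),\qquad \xi_2=\tfrac{\delta\mu_1}{\theta-\gamma\delta}(1+O(|\mu|))-\tfrac{\theta\mu_2}{\theta-\gamma\delta}(1+O(|\mu|)).$$ The curve $T_1$ consists of the small parameters with $\mu_1/\theta>0$ for which the second coordinate of $E_3$ is $0$; on it $E_3$ and $E_1$ coincide. ''Transcritical bifurcation curve'' means: for each fixed small $\mu_1$ with $\mu_1/\theta>0$, taking $\mu_2$ as the bifurcation parameter, the system undergoes a transcritical bifurcation (in the sense of Sotomayor's theorem) at the equilibrium $E_1=E_3$ when $(\mu_1,\mu_2)$ crosses $T_1$. That is, writing the system as $\dot\xi=f(\xi,\mu)$,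 at the point $(\xi_0,\mu_0)$ with $\xi_0=E_1$, $\mu_0\in T_1$, the Jacobian $Df$ has a simple zero eigenvalue with right and left null vectors $v,w$, the other eigenvalue being non-zero, and $w^Tf_{\mu_2}=0$, $w^T[Df_{\mu_2}(v)]\ne 0$, $w^T[D^2f(v,v)]\neq 0$. Here $f_{\mu_2}=\partial f/\partial\mu_2$ and $D$ denotes differentiation in $\xi$. *)

(* Defs.v *)
From HB Require Import structures.
From mathcomp Require Export all_boot all_order all_algebra.
From mathcomp Require Export all_classical all_reals all_analysis.
Export Order.TTheory GRing.Theory Num.Theory.
Export numFieldNormedType.Exports.

Set Implicit Arguments.
Unset Strict Implicit.
Unset Printing Implicit Defensive.

Local Open Scope classical_set_scope.
Local Open Scope ring_scope.

(* The coordinates of x : 'rV_2 are x 0 0 and x 0 1; the derivative along the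
   i-th coordinate is the directional derivative along 'e_i = delta_mx 0 i. *)

Definition row2 (R : realType) (a b : R) : 'rV[R]_2 :=
  \row_i (if i == 0 then a else b).

Definition dot (R : realType) (n : nat) (u v : 'rV[R]_n) : R :=
  \sum_i u 0 i * v 0 i.

(* Iterated partial derivatives of f up to order k exist at x and are
   continuous at x.  Only meaningful when required for all x in an open set. *)
Fixpoint Ck (R : realType) (k : nat) (f : 'rV[R]_2 -> R) (x : 'rV[R]_2)
    {struct k} : Prop :=
  {for x, continuous f} /\
  if k is k'.+1 then
    forall i : 'I_2, derivable f x 'e_i /\
      Ck k' (fun y => 'D_('e_i) f y) x
  else True.

Definition smooth_near (R : realType) (x : 'rV[R]_2) (f : 'rV[R]_2 -> R) :=
  \forall y \near x, forall k : nat, Ck k f y.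

Section System.
Variables (R : realType) (theta gamma delta M N S P : 'rV[R]_2 -> R).

(* The two parenthesised factors of the right-hand side. *)
Definition rates (mu xi : 'rV[R]_2) : 'rV[R]_2 :=
  let x := xi 0 0 in let y := xi 0 1 in
  row2
    (mu 0 0 - theta mu * x + gamma mu * y - M mu * x * y + N mu * x ^+ 2)
    (mu 0 1 - delta mu * x + y + S mu * x ^+ 2 + P mu * y ^+ 2).

Definition field (mu xi : 'rV[R]_2) : 'rV[R]_2 :=
  \row_i (xi 0 i * rates mu xi 0 i).

(* E1 = (x, 0) is determined by axis_rate mu x = 0. *)
Definition axis_rate (mu : 'rV[R]_2) (x : R) : R :=
  mu 0 0 - theta mu * x + N mu * x ^+ 2.

End System.

(* E is the solution near the origin of G mu x = 0: it is continuous at 0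
   with E 0 = 0, solves the equation for small mu, and is the only solution
   with x close to 0.  This determines E on a neighbourhood of 0. *)
Definition solution_branch (R : realType) (V W Z : normedModType R)
    (G : V -> W -> Z) (E : V -> W) : Prop :=
  [/\ E mu @[mu --> (0 : V)] --> (0 : W),
      \forall mu \near (0 : V), G mu (E mu) = 0
    & \forall mu \near (0 : V) & x \near (0 : W), G mu x = 0 -> x = E mu].

(* Sotomayor's transcritical conditions for dx/dt = F s x at (x0, s0), with s
   the bifurcation parameter.  MathComp's jacobian acts on row vectors from
   the right, so J is the transpose of the usual Jacobian matrix DF: the right
   null vector v of DF satisfies v *m J = 0 and the left one w satisfies
   w *m J^T = 0. *)
Definition transcritical (R : realType) (F : R -> 'rV[R]_2 -> 'rV[R]_2)
    (x0 : 'rV[R]_2) (s0 : R) : Prop :=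
  let J := jacobian (F s0) x0 in
  let F_s := fun x => derive1 (F ^~ x) s0 in
  [/\ F s0 x0 = 0,
      mup 0 (char_poly J) = 1%N,
      exists2 l : R, l != 0 & eigenvalue J l
    & exists v w : 'rV[R]_2,
        [/\ v != 0 /\ v *m J = 0,
            w != 0 /\ w *m J^T = 0,
            dot w (F_s x0) = 0,
            dot w ('D_v F_s x0) != 0
          & dot w ('D_v (fun x => 'D_v (F s0) x) x0) != 0]].

(* T1, given theta0 = theta(0) and the branch E3; it is only meaningful for
   small parameters. *)
Definition T1 (R : realType) (theta0 : R) (E3 : 'rV[R]_2 -> 'rV[R]_2) :
    set 'rV[R]_2 :=
  [set mu : 'rV[R]_2 | 0 < mu 0 0 / theta0 /\ E3 mu 0 1 = 0].

(* Main.v *)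
(** Both equilibria and the curve [T1] come from one parametric contraction
    argument: after inverting the constant linear part, each equation reads
    [x = T mu x] with [T mu] a 1/2-contraction near 0.  The coefficients are
    Lipschitz near 0, so [E1 = mu1 / theta(0) + rho], where the increments of
    [rho] satisfy [|rho mu - rho nu| <= C (|mu| + |nu|) |mu - nu|].
    Functions with this property behave like quadratic remainders and are stable
    under the needed products, so the condition [E3 mu 0 1 = 0], which is
    [mu2 = delta E1 - S E1^2], becomes [mu2 = delta(0)/theta(0) mu1 + rho' mu];
    this is again a contraction in [mu2], and its fixed point [h mu1] inherits
    continuity and the [O(mu1^2)] expansion.

    On [T1] the transposed Jacobian at [(x, 0)], [x = E1], is lower triangular
    with diagonal [x (2 N x - theta), 0]; the null vectors are
    [v = ((gamma - M x) / (theta - 2 N x), 1)] and [w = (0, 1)], and Sotomayor's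
    last two quantities tend to [1] and [2 (1 - gamma delta / theta)] as
    [mu --> 0]. *)
From HB Require Import structures.
From mathcomp Require Import ring lra.
Require Import Defs.

Set Implicit Arguments.
Unset Strict Implicit.
Unset Printing Implicit Defensive.

Local Open Scope classical_set_scope.
Local Open Scope ring_scope.

(* Matrices carry both structures, but not their join [completeNormedModType]. *)
HB.instance Definition _ (R : realType) (m n : nat) :=
  NormedModule.on 'M[R]_(m, n).

(** * Parametric fixed points and solution branches *)

(** Banach's theorem applies on one closed ball of radius [r] for all small [mu]: the bound
    [|T mu 0| <= r / 2] makes the ball invariant. Comparing [T mu (E mu)] with [T mu 0] gives
    [|E mu| <= 2 |T mu 0|], hence the limit of [E] at 0. *)
Lemma parametric_fixpoint (R : realType) (V : normedModType R)
    (W : completeNormedModType R) (T : V -> W -> W) :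
  (\forall mu \near (0 : V) & p \near (0 : W * W),
     `|T mu p.1 - T mu p.2| <= 2^-1 * `|p.1 - p.2|) ->
  T mu 0 @[mu --> (0 : V)] --> (0 : W) ->
  exists E : V -> W, solution_branch (fun mu x => x - T mu x) E.
Proof.
move=> contr T0.
have [r r0 ctr] : exists2 r : R, 0 < r & \forall mu \near (0 : V),
    forall x y : W, `|x| <= r -> `|y| <= r ->
      `|T mu x - T mu y| <= 2^-1 * `|x - y|.
  case: contr => -[A B] /= [A0 B0] AB.
  have /nbhs_ballP[r /= r0 rB] := B0.
  (* Halving puts the closed ball inside the open one given by the neighbourhood. *)
  exists (r / 2); first by rewrite divr_gt0.
  apply: filterS A0 => mu Amu x y xr yr.
  apply: (AB (mu, (x, y))); split => //=; apply: rB; split => /=;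
    rewrite -ball_normE /ball_ /= sub0r normrN;
    apply: le_lt_trans; eassumption || lra.
have small : \forall mu \near (0 : V), `|T mu 0| <= r / 2.
  by move/cvgr0Pnorm_le: T0; apply; rewrite divr_gt0.
have fixed : \forall mu \near (0 : V), exists x : W,
    `|x| <= r /\ x = T mu x.
  apply: filterS2 ctr small => mu ctr small.
  pose U := [set x : W | `|x| <= r].
  have funU : set_fun U U (T mu).
    move=> x; rewrite /U /= => xr; rewrite -[T mu x](subrK (T mu 0)).
    apply: le_trans (ler_normD _ _) _.
    have := ctr x 0 xr; rewrite normr0 subr0 => /(_ (ltW r0)) h.
    move: xr h small; lra.
  pose f : {fun U >-> U} := mkfun_fun funU.
  have [|||x Ux fx] := @banach_fixed_point R W U f.
  - exists 2^-1%:nng; split => /=; first by lra.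
    by move=> [x y] [/= Ux Uy]; exact: ctr.
  - apply: (@closed_comp _ _ (fun x : W => `|x|) [set t | t <= r]).
      by move=> x _; exact: norm_continuous.
    exact: closed_le.
  - by exists 0; rewrite /U /= normr0 ltW.
  - by exists x.
(* The default 0 is taken only where no fixed point exists, hence away from the origin. *)
pose E mu : W := xget 0 [set x : W | `|x| <= r /\ x = T mu x].
have EP : \forall mu \near (0 : V), `|E mu| <= r /\ E mu = T mu (E mu).
  by apply: filterS fixed => mu [x xP]; rewrite /E; case: xgetP => [y _|/(_ x)].
exists E; split.
- apply/cvgr0Pnorm_le => e e0.
  have T0e : \forall mu \near (0 : V), `|T mu 0| <= e / 2.
    by move/cvgr0Pnorm_le: T0; apply; rewrite divr_gt0.
  apply: filterS3 ctr EP T0e => mu ctr [Er Efix] T0e.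
  have := ctr (E mu) 0 Er; rewrite normr0 subr0 -Efix => /(_ (ltW r0)) h.
  have := ler_normD (E mu - T mu 0) (T mu 0); rewrite subrK => h'.
  lra.
- by apply: filterS EP => mu [_ <-]; rewrite subrr.
- exists ([set mu | (forall x y : W, `|x| <= r -> `|y| <= r ->
      `|T mu x - T mu y| <= 2^-1 * `|x - y|) /\
      (`|E mu| <= r /\ E mu = T mu (E mu))], [set x : W | `|x| <= r]).
    split => /=; first exact: filterI ctr EP.
    apply/nbhs_ballP; exists r => //= x.
    by rewrite -ball_normE /ball_ /= sub0r normrN => /ltW.
  move=> [mu x] /= [[{}ctr [Er Efix]] xr] /eqP; rewrite subr_eq0 => /eqP xfix.
  have := ctr x (E mu) xr Er; rewrite -xfix -Efix => h.
  apply/eqP; rewrite -subr_eq0 -normr_le0.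
  have := normr_ge0 (x - E mu); lra.
Qed.

Lemma solution_branch_iff (R : realType) (V W Z Z' : normedModType R)
    (G : V -> W -> Z) (G' : V -> W -> Z') (E : V -> W) :
  (forall mu x, G mu x = 0 <-> G' mu x = 0) ->
  solution_branch G E -> solution_branch G' E.
Proof.
move=> GG' [E0 EG Eu]; split => //.
- by apply: filterS EG => mu /GG'.
- by apply: filterS Eu => -[mu x] /= Eu /GG'.
Qed.

(** Tending to 0 places [f mu] in the uniqueness neighbourhood. The equation is a premise at each
    single [mu], so [f] may solve it only on a subset such as [T1]. *)
Lemma solution_branch_unique (R : realType) (V W Z : normedModType R)
    (G : V -> W -> Z) (E f : V -> W) :
  solution_branch G E -> f mu @[mu --> (0 : V)] --> (0 : W) ->
  \forall mu \near (0 : V), G mu (f mu) = 0 -> f mu = E mu.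
Proof.
move=> [_ _ [[A B] /= [A0 B0] AB]] f0.
apply: filterS2 A0 (f0 _ B0) => mu Amu Bmu.
exact: (AB (mu, f mu)).
Qed.

(** The limit is taken over full neighbourhoods of 0, which contain 0 itself. *)
Lemma solution_branch0 (R : realType) (V W Z : normedModType R)
    (G : V -> W -> Z) (E : V -> W) : solution_branch G E -> E 0 = 0.
Proof.
move=> [E0 _ _]; apply/eqP; rewrite -normr_le0; apply/ler_addgt0Pl => e e0.
rewrite addr0.
have /nbhs_singleton// : \forall mu \near (0 : V), `|E mu| <= e.
by move/cvgr0Pnorm_le: E0; apply.
Qed.

(** * Restriction to lines and a mean value inequality *)

Section Line.
Variables (R : realType) (V W : normedModType R) (f : V -> W) (g : R -> W).
Variables (p v : V) (u : R).
Hypothesis gE : forall s, g s = f (p + s *: v).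

(** The two difference quotients are the same function of [h], so derivability and the derivative
    transfer without a chain rule. *)
Let quotientE : (fun h : R => h^-1 *: ((g \o shift u) (h *: (1 : R)) - g u)) =
  (fun h => h^-1 *: ((f \o shift (p + u *: v)) (h *: v) - f (p + u *: v))).
Proof.
apply/funext => h /=; rewrite !gE; congr (_ *: (f _ - _)).
by rewrite addrCA -scalerDl [h *: 1]mulr1.
Qed.

Lemma derivable_line : derivable f (p + u *: v) v -> derivable g u 1.
Proof. by rewrite /derivable quotientE. Qed.

Lemma derive_line : 'D_1 g u = 'D_v f (p + u *: v).
Proof. by rewrite /derive quotientE. Qed.

End Line.

(** Mean value theorem on a segment, which stays in the ball by convexity. Only the derivative along
    [v] is controlled, so increments are later estimated one coordinate at a time. *)
Lemma bounded_derive_line (R : realType) (V : normedModType R) (f : V -> R)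
    (v : V) (r B : R) :
  (forall q, `|q| < r -> derivable f q v /\ `|'D_v f q| <= B) ->
  forall (p : V) (t : R), `|p| < r -> `|p + t *: v| < r ->
  `|f (p + t *: v) - f p| <= B * `|t|.
Proof.
move=> fB.
have pos (p : V) (t : R) : 0 <= t -> `|p| < r -> `|p + t *: v| < r ->
    `|f (p + t *: v) - f p| <= B * `|t|.
  rewrite le_eqVlt => /predU1P[<-|t0] pr ptr.
    by rewrite scale0r addr0 subrr !normr0 mulr0.
  have inball u : 0 <= u -> u <= t -> `|p + u *: v| < r.
    move=> u0 ut; rewrite -(ltr_pM2l t0).
    rewrite -[X in X * _](gtr0_norm t0) -normrZ.
    (* The intermediate point as a convex combination of the end points, multiplied through by
       [t]. *)
    have -> : t *: (p + u *: v) = (t - u) *: p + u *: (p + t *: v).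
      rewrite !scalerDr !scalerA addrA -scalerDl subrK.
      by rewrite [t * u]mulrC.
    apply: le_lt_trans (ler_normD _ _) _; rewrite !normrZ.
    rewrite (ger0_norm u0) ger0_norm ?subr_ge0//.
    have [->|u_neq0] := eqVneq u 0; first by rewrite subr0 mul0r addr0 ltr_pM2l.
    have : 0 < u by rewrite lt_def u_neq0.
    have : (t - u) * `|p| <= (t - u) * r by rewrite ler_wpM2l ?subr_ge0// ltW.
    move=> h1 u0'.
    have : u * `|p + t *: v| < u * r by rewrite ltr_pM2l.
    by move: h1; rewrite mulrBl; lra.
  pose g s := f (p + s *: v).
  have gd u : 0 <= u -> u <= t -> derivable g u 1.
    move=> u0 ut; apply: (@derivable_line _ _ _ f _ p v) => //.
    by have [] := fB _ (inball u u0 ut).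
  have [|u||c] := @MVT_segment R g (fun s => 'D_v f (p + s *: v)) 0 t.
  - exact: ltW.
  - rewrite in_itv /= => /andP[/ltW u0 /ltW ut].
    by split; [exact: gd|exact: derive_line].
  - apply: derivable_within_continuous => u; rewrite in_itv /= => /andP[u0 ut].
    exact: gd.
  - rewrite in_itv /= => /andP[c0 ct]; rewrite /g scale0r addr0 subr0 => ->.
    by rewrite normrM ler_wpM2r//; have [] := fB _ (inball c c0 ct).
(* For negative [t] the segment is run through from its other end. *)
move=> p t pr ptr; have [t0|/ltW t0] := leP 0 t; first exact: pos.
have := pos (p + t *: v) (- t); rewrite scaleNr addrK normrN distrC; apply => //.
by rewrite oppr_ge0.
Qed.

Lemma near_norm_lt (R : realType) (V : normedModType R) (e : R) :
  0 < e -> \forall x \near (0 : V), `|x| < e.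
Proof.
move=> e0; apply/nbhs_ballP; exists e => //= x.
by rewrite -ball_normE /ball_ /= sub0r normrN.
Qed.

(** * Lipschitz functions and quadratic remainders near 0 *)

Section LipschitzNear0.
Variables (R : realType) (V : normedModType R).
Implicit Types f g : V -> R.

Definition lip0 f := exists C : R, exists A : set V, [/\ 0 <= C,
  nbhs (0 : V) A & forall x y, A x -> A y -> `|f x - f y| <= C * `|x - y|].

(** On a ball of radius [r] the Lipschitz constant is at most [2 C r], which gives contractions; the
    choice [y = 0] gives a quadratic bound. *)
Definition qlip0 f := exists C : R, exists A : set V, [/\ 0 <= C,
  nbhs (0 : V) A &
  forall x y, A x -> A y -> `|f x - f y| <= C * (`|x| + `|y|) * `|x - y|].

Lemma lip0_cvg f : lip0 f -> f x @[x --> (0 : V)] --> f 0.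
Proof.
move=> [C [A [C0 A0 fC]]]; apply/cvgrPdist_le => e e0.
have : 0 < e / (C + 1) by rewrite divr_gt0// ltr_wpDl.
move=> /near_norm_lt-/(_ V) small.
have Az := nbhs_singleton A0; apply: filterS2 A0 small => x Ax.
rewrite ltr_pdivlMr ?ltr_wpDl// mulrC mulrDl mul1r => xe.
rewrite distrC; apply: le_trans (fC _ _ Ax Az) _.
by rewrite subr0; have := normr_ge0 x; lra.
Qed.

Lemma lip0_cst c : lip0 (fun=> c).
Proof.
exists 0, setT; split => //; first exact: filterT.
by move=> x y _ _; rewrite subrr normr0 mul0r.
Qed.

Lemma lip0D f g : lip0 f -> lip0 g -> lip0 (fun x => f x + g x).
Proof.
move=> [C [A [C0 A0 fC]]] [D [B [D0 B0 gD]]]; exists (C + D), (A `&` B).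
split; [exact: addr_ge0 | exact: filterI |] => x y [Ax Bx] [Ay By].
have -> : f x + g x - (f y + g y) = (f x - f y) + (g x - g y) by ring.
by apply: le_trans (ler_normD _ _) _; rewrite mulrDl lerD ?fC ?gD.
Qed.

Lemma lip0N f : lip0 f -> lip0 (fun x => - f x).
Proof.
move=> [C [A [C0 A0 fC]]]; exists C, A; split => // x y Ax Ay.
by rewrite -opprD normrN fC.
Qed.

Lemma lip0_bounded f : lip0 f -> \forall x \near (0 : V), `|f x| <= `|f 0| + 1.
Proof.
move=> /lip0_cvg/cvgrPdist_le/(_ 1 ltr01); apply: filterS => x.
by have := ler_normB (f 0) (f 0 - f x); rewrite opprB addrC subrK; lra.
Qed.

Let normBM (a b a' b' : R) :
  `|a * b - a' * b'| <= `|a| * `|b - b'| + `|b'| * `|a - a'|.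
Proof.
have -> : a * b - a' * b' = a * (b - b') + b' * (a - a') by ring.
by rewrite -!normrM ler_normD.
Qed.

Lemma lip0M f g : lip0 f -> lip0 g -> lip0 (fun x => f x * g x).
Proof.
move=> fl gl; have fb := lip0_bounded fl; have gb := lip0_bounded gl.
move: fl gl => [C [A [C0 A0 fC]]] [D [B [D0 B0 gD]]].
exists ((`|f 0| + 1) * D + (`|g 0| + 1) * C).
exists ((A `&` B) `&` [set x | `|f x| <= `|f 0| + 1 /\ `|g x| <= `|g 0| + 1]).
split; first by rewrite addr_ge0// mulr_ge0// addr_ge0.
  exact: filterI (filterI A0 B0) (filterI fb gb).
move=> x y [[Ax Bx] [fx _]] [[Ay By] [_ gy]].
apply: le_trans (normBM _ _ _ _) _; rewrite mulrDl -!mulrA.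
by apply: lerD; apply: ler_pM; rewrite ?fC ?gD.
Qed.

(** [normBM] evaluates one factor at [x] and the other at [y]; as both vanish at 0, [|f x| <= C |x|]
    and [|g y| <= D |y|] produce the factor [|x| + |y|]. *)
Lemma qlip0M f g : lip0 f -> lip0 g -> f 0 = 0 -> g 0 = 0 ->
  qlip0 (fun x => f x * g x).
Proof.
move=> [C [A [C0 A0 fC]]] [D [B [D0 B0 gD]]] f0 g0; exists (C * D), (A `&` B).
split; [exact: mulr_ge0 | exact: filterI |] => x y [Ax Bx] [Ay By].
have fx : `|f x| <= C * `|x|.
  by have := fC _ _ Ax (nbhs_singleton A0); rewrite f0 !subr0.
have gy : `|g y| <= D * `|y|.
  by have := gD _ _ By (nbhs_singleton B0); rewrite g0 !subr0.
apply: le_trans (normBM _ _ _ _) _.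
have -> : C * D * (`|x| + `|y|) * `|x - y| =
  C * `|x| * (D * `|x - y|) + D * `|y| * (C * `|x - y|) by ring.
by apply: lerD; apply: ler_pM; rewrite ?fC ?gD.
Qed.

Lemma qlip0D f g : qlip0 f -> qlip0 g -> qlip0 (fun x => f x + g x).
Proof.
move=> [C [A [C0 A0 fC]]] [D [B [D0 B0 gD]]]; exists (C + D), (A `&` B).
split; [exact: addr_ge0 | exact: filterI |] => x y [Ax Bx] [Ay By].
have -> : f x + g x - (f y + g y) = (f x - f y) + (g x - g y) by ring.
by apply: le_trans (ler_normD _ _) _; rewrite -mulrA mulrDl !mulrA lerD ?fC ?gD.
Qed.

Lemma qlip0Z c f : qlip0 f -> qlip0 (fun x => c * f x).
Proof.
move=> [C [A [C0 A0 fC]]]; exists (`|c| * C), A; split => //.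
  exact: mulr_ge0.
by move=> x y Ax Ay; rewrite -mulrBr normrM -!mulrA ler_wpM2l// mulrA fC.
Qed.

End LipschitzNear0.

(** * Coordinates in the plane; smooth functions are Lipschitz near 0 *)

Section Plane.
Variable R : realType.
Implicit Types a b r : R.

Lemma row2E0 a b : row2 a b 0 0 = a.
Proof. by rewrite mxE. Qed.

Lemma row2E1 a b : row2 a b 0 1 = b.
Proof. by rewrite mxE. Qed.

Lemma ord2P (i : 'I_2) : i = 0 \/ i = 1.
Proof. by case: i => -[|[|//]] ?; [left|right]; apply: val_inj. Qed.

Lemma row2_eta (p : 'rV[R]_2) : row2 (p 0 0) (p 0 1) = p.
Proof. by apply/rowP => i; case: (ord2P i) => ->; rewrite (row2E0, row2E1). Qed.

Lemma norm_row2 a b : `|row2 a b| = Num.max `|a| `|b|.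
Proof.
rewrite [LHS]mx_normrE; apply/le_anti/andP; split.
  apply/bigmax_leP; split; first by rewrite le_max normr_ge0.
  by move=> [i j] _ /=; rewrite mxE le_max; case: eqP => _; rewrite lexx ?orbT.
rewrite ge_max; apply/andP; split.
  by apply: le_trans (le_bigmax _ _ (ord0, 0)); rewrite /= row2E0.
by apply: le_trans (le_bigmax _ _ (ord0, 1)); rewrite /= row2E1.
Qed.

Lemma row2B a b c d : row2 a b - row2 c d = row2 (a - c) (b - d).
Proof. by apply/rowP => i; rewrite !mxE; case: eqP. Qed.

Lemma row2_shift0 a b t : row2 a b + t *: 'e_0 = row2 (a + t) b.
Proof.
by apply/rowP => i; rewrite !mxE; case: (ord2P i) => ->;
  rewrite /= ?mulr1 ?mulr0 ?addr0.
Qed.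

Lemma row2_shift1 a b t : row2 a b + t *: 'e_1 = row2 a (b + t).
Proof.
by apply/rowP => i; rewrite !mxE; case: (ord2P i) => ->;
  rewrite /= ?mulr1 ?mulr0 ?addr0.
Qed.

(** Continuity of the partial derivatives at 0 bounds them by some [B] near 0. The path from
    [(c, d)] to [(a, b)] turns at [(c, b)], which stays in the ball of the sup norm, and each leg
    costs at most [B] times the distance. *)
Lemma smooth_near_lip0 (f : 'rV[R]_2 -> R) : smooth_near 0 f -> lip0 f.
Proof.
move=> sf.
have f1 : \forall p \near (0 : 'rV[R]_2), forall i : 'I_2, derivable f p 'e_i.
  by apply: filterS sf => p /(_ 1%N)[_ fp] i; have [] := fp i.
have [B B0 fB] : exists2 B, 0 <= B & \forall p \near (0 : 'rV[R]_2),
    forall i : 'I_2, `|'D_('e_i) f p| <= B.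
  have bnd (i : 'I_2) : \forall p \near (0 : 'rV[R]_2),
      `|'D_('e_i) f p| <= `|'D_('e_i) f 0| + 1.
    have [_ /(_ i)[_ [+ _]]] := nbhs_singleton sf 1%N.
    move=> /cvgrPdist_le/(_ 1 ltr01); apply: filterS => p.
    have := ler_normB ('D_('e_i) f 0) ('D_('e_i) f 0 - 'D_('e_i) f p).
    by rewrite opprB addrC subrK; lra.
  have b0 (i : 'I_2) : 0 <= `|'D_('e_i) f 0| + 1 by apply: addr_ge0.
  exists ((`|'D_('e_0) f 0| + 1) + (`|'D_('e_1) f 0| + 1)).
    exact: addr_ge0 (b0 0) (b0 1).
  apply: filterS2 (bnd 0) (bnd 1) => p p0 p1 i; case: (ord2P i) => ->.
    by apply: le_trans p0 _; rewrite lerDl; exact: b0.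
  by apply: le_trans p1 _; rewrite lerDr; exact: b0.
have [r /= r0 rP] := (nbhs_ballP _ _).1 (filterI f1 fB).
have fr q : `|q| < r -> forall i : 'I_2,
    derivable f q 'e_i /\ `|'D_('e_i) f q| <= B.
  move=> qr i; have [|dq bq] := rP q.
    by rewrite -ball_normE /ball_ /= sub0r normrN.
  by split.
have step i := bounded_derive_line (fun q qr => fr q qr i).
exists (B + B), [set q | `|q| < r].
split; [exact: addr_ge0|exact: (@near_norm_lt R 'rV[R]_2 r)|] => p q /=.
rewrite -(row2_eta p) -(row2_eta q) row2B.
move: (p 0 0) (p 0 1) (q 0 0) (q 0 1) => a b c d.
rewrite !norm_row2 !gt_max => /andP[ar br] /andP[cr dr].
have h0 : `|f (row2 a b) - f (row2 c b)| <= B * `|a - c|.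
  have := step 0 (row2 c b) (a - c); rewrite row2_shift0 addrC subrK.
  by apply; rewrite norm_row2 gt_max; apply/andP.
have h1 : `|f (row2 c b) - f (row2 c d)| <= B * `|b - d|.
  have := step 1 (row2 c d) (b - d); rewrite row2_shift1 addrC subrK.
  by apply; rewrite norm_row2 gt_max; apply/andP.
have -> : f (row2 a b) - f (row2 c d) =
  (f (row2 a b) - f (row2 c b)) + (f (row2 c b) - f (row2 c d)) by ring.
apply: le_trans (ler_normD _ _) _; rewrite mulrDl; apply: lerD.
  by apply: le_trans h0 _; rewrite ler_wpM2l// le_max lexx.
by apply: le_trans h1 _; rewrite ler_wpM2l// le_max lexx orbT.
Qed.

End Plane.

(** * Derivatives of the vector field and Sotomayor's conditions *)

Section Transcritical.
Variable R : realType.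
Implicit Types x v w xi : 'rV[R]_2.

Lemma is_derive_coord x v i : is_derive x v (fun y => y 0 i) (v 0 i).
Proof.
have di : derivable (id : 'rV[R]_2 -> 'rV[R]_2) x v by exact: derivable_id.
split; first by have /derivable_mxP := di; apply.
by have := derive_mx di; rewrite derive_id => /rowP/(_ i); rewrite mxE.
Qed.

Lemma rates0E (t g d m n s p : 'rV[R]_2 -> R) mu xi :
  rates t g d m n s p mu xi 0 0 = mu 0 0 - t mu * xi 0 0 + g mu * xi 0 1
    - m mu * xi 0 0 * xi 0 1 + n mu * xi 0 0 ^+ 2.
Proof. by rewrite /rates row2E0. Qed.

Lemma rates1E (t g d m n s p : 'rV[R]_2 -> R) mu xi :
  rates t g d m n s p mu xi 0 1 = mu 0 1 - d mu * xi 0 0 + xi 0 1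
    + s mu * xi 0 0 ^+ 2 + p mu * xi 0 1 ^+ 2.
Proof. by rewrite /rates row2E1. Qed.

Lemma is_derive_rates0 (t g d m n s p : 'rV[R]_2 -> R) mu xi v :
  is_derive xi v (fun y => rates t g d m n s p mu y 0 0)
   (- t mu * v 0 0 + g mu * v 0 1 - m mu * (v 0 0 * xi 0 1 + xi 0 0 * v 0 1)
     + 2 * n mu * xi 0 0 * v 0 0).
Proof.
under eq_fun do rewrite rates0E.
have c0 := is_derive_coord xi v 0.
have c1 := is_derive_coord xi v 1.
apply: is_derive_eq.
rewrite /GRing.scale /=; ring.
Qed.

Lemma is_derive_rates1 (t g d m n s p : 'rV[R]_2 -> R) mu xi v :
  is_derive xi v (fun y => rates t g d m n s p mu y 0 1)
   (- d mu * v 0 0 + v 0 1 + 2 * s mu * xi 0 0 * v 0 0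
     + 2 * p mu * xi 0 1 * v 0 1).
Proof.
under eq_fun do rewrite rates1E.
have c0 := is_derive_coord xi v 0.
have c1 := is_derive_coord xi v 1.
apply: is_derive_eq.
rewrite /GRing.scale /=; ring.
Qed.

Lemma dot_e1 x : dot 'e_1 x = x 0 1.
Proof.
by rewrite /dot !big_ord_recl big_ord0 !mxE /= mul0r mul1r addr0 add0r;
  congr (x _ _); exact: val_inj.
Qed.

Lemma derivable_row2 (V : normedModType R) (f : V -> 'rV[R]_2) (x v : V) :
  derivable (fun y => f y 0 0) x v -> derivable (fun y => f y 0 1) x v ->
  derivable f x v.
Proof.
move=> f0 f1; apply/derivable_mxP => i j; rewrite [i]ord1.
by case: (ord2P j) => ->; [exact: f0|exact: f1].
Qed.

Lemma derive_coord (V : normedModType R) (f : V -> 'rV[R]_2) (x v : V) j :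
  derivable f x v -> 'D_v f x 0 j = 'D_v (fun y => f y 0 j) x.
Proof. by move=> /derive_mx ->; rewrite mxE. Qed.

Lemma differentiable_row2 (V : normedModType R) (f : V -> 'rV[R]_2) (x : V) :
  differentiable (fun y => f y 0 0) x -> differentiable (fun y => f y 0 1) x ->
  differentiable f x.
Proof.
move=> f0 f1.
have -> : f = (fun y => f y 0 0 *: 'e_0) + (fun y => f y 0 1 *: 'e_1).
  apply/funext => y; apply/rowP => i; rewrite !mxE.
  by case: (ord2P i) => ->; rewrite /= ?mulr1 ?mulr0 ?addr0 ?add0r.
by apply: differentiableD; exact: differentiableZl.
Qed.

Section Field.
Variables (t g d m n s p : 'rV[R]_2 -> R).
Let F := field t g d m n s p.
Let r := rates t g d m n s p.

Let fieldE mu xi i : F mu xi 0 i = xi 0 i * r mu xi 0 i.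
Proof. by rewrite mxE. Qed.

Lemma differentiable_field mu xi : differentiable (F mu) xi.
Proof.
have c i := differentiable_coord xi 0 i.
apply: differentiable_row2.
  under eq_fun do rewrite fieldE /r rates0E.
  by do ?[apply: differentiableD|apply: differentiableN|apply: differentiableM|
    apply: differentiableX|apply: differentiable_cst|exact: c].
under eq_fun do rewrite fieldE /r rates1E.
by do ?[apply: differentiableD|apply: differentiableN|apply: differentiableM|
  apply: differentiableX|apply: differentiable_cst|exact: c].
Qed.

(** The product rule is left unexpanded: the first summand drops out at an equilibrium where the
    rates vanish. *)
Lemma derive_field0 mu xi v : 'D_v (F mu) xi 0 0 = v 0 0 * r mu xi 0 0 +
  xi 0 0 * (- t mu * v 0 0 + g mu * v 0 1
    - m mu * (v 0 0 * xi 0 1 + xi 0 0 * v 0 1) + 2 * n mu * xi 0 0 * v 0 0).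
Proof.
rewrite derive_coord; last exact/diff_derivable/differentiable_field.
under eq_fun do rewrite fieldE.
have c0 := is_derive_coord xi v 0.
have c1 := is_derive_rates0 t g d m n s p mu xi v.
by rewrite derive_val /GRing.scale /=; ring.
Qed.

Lemma derive_field1 mu xi v : 'D_v (F mu) xi 0 1 = v 0 1 * r mu xi 0 1 +
  xi 0 1 * (- d mu * v 0 0 + v 0 1 + 2 * s mu * xi 0 0 * v 0 0
     + 2 * p mu * xi 0 1 * v 0 1).
Proof.
rewrite derive_coord; last exact/diff_derivable/differentiable_field.
under eq_fun do rewrite fieldE.
have c0 := is_derive_coord xi v 1.
have c1 := is_derive_rates1 t g d m n s p mu xi v.
by rewrite derive_val /GRing.scale /=; ring.
Qed.

Let row2_line a b : row2 a b = row2 a 0 + b *: 'e_1 :> 'rV[R]_2.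
Proof. by rewrite row2_shift1 add0r. Qed.

Let is_derive_second (f : 'rV[R]_2 -> R) a b :
  derivable f (row2 a b) 'e_1 ->
  is_derive b 1 (fun u : R => f (row2 a u)) ('D_('e_1) f (row2 a b)).
Proof.
move=> df.
have fE u : f (row2 a u) = f (row2 a 0 + u *: 'e_1) by rewrite -row2_line.
split; first by apply: derivable_line fE _; rewrite -row2_line.
by rewrite (derive_line _ fE) -row2_line.
Qed.

Variables a b x : R.
Let mu := row2 a b.
Let E := row2 x 0.
Let D (f : 'rV[R]_2 -> R) := 'D_('e_1) f mu.

Hypothesis coef_derivable :
  [/\ derivable t mu 'e_1, derivable g mu 'e_1, derivable d mu 'e_1
    & [/\ derivable m mu 'e_1, derivable n mu 'e_1, derivable s mu 'e_1
    & derivable p mu 'e_1]].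

(** This is the derivative in [mu2]; the isolated 1 comes from [mu2] itself. It is computed at every
    [xi] because it is differentiated in [xi] afterwards. *)
Lemma derive_field_second xi :
  derivable (fun u : R => F (row2 a u) xi) b 1 /\
  derive1 (fun u : R => F (row2 a u) xi) b =
  row2 (xi 0 0 * (- D t * xi 0 0 + D g * xi 0 1 - D m * xi 0 0 * xi 0 1
          + D n * xi 0 0 ^+ 2))
       (xi 0 1 * (1 - D d * xi 0 0 + D s * xi 0 0 ^+ 2 + D p * xi 0 1 ^+ 2)).
Proof.
have [dt dg dd [dm dn ds dp]] := coef_derivable.
have it := is_derive_second dt; have ig := is_derive_second dg.
have id' := is_derive_second dd; have im := is_derive_second dm.
have in' := is_derive_second dn; have is' := is_derive_second ds.
have ip := is_derive_second dp.
have F0 : is_derive b 1 (fun u : R => F (row2 a u) xi 0 0)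
    (xi 0 0 * (- D t * xi 0 0 + D g * xi 0 1 - D m * xi 0 0 * xi 0 1
          + D n * xi 0 0 ^+ 2)).
  under eq_fun do rewrite fieldE /r rates0E row2E0.
  by apply: is_derive_eq; rewrite /GRing.scale /D /mu /=; ring.
have F1 : is_derive b 1 (fun u : R => F (row2 a u) xi 0 1)
    (xi 0 1 * (1 - D d * xi 0 0 + D s * xi 0 0 ^+ 2 + D p * xi 0 1 ^+ 2)).
  under eq_fun do rewrite fieldE /r rates1E row2E1.
  by apply: is_derive_eq; rewrite /GRing.scale /D /mu /=; ring.
have dF : derivable (fun u : R => F (row2 a u) xi) b 1.
  by apply: derivable_row2; exact: ex_derive.
split => //; rewrite derive1E; apply/rowP => i; rewrite derive_coord//.
by case: (ord2P i) => ->; rewrite derive_val ?row2E0 ?row2E1.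
Qed.

Let J := jacobian (F mu) E.
Let v0 := (g mu - m mu * x) / (t mu - 2 * n mu * x).

(** With [x != 0], [hyp1] makes the second eigenvalue non-zero; [hyp2] is the mixed Sotomayor
    quantity for [v = (v0, 1)] and [w = (0, 1)], and [hyp3] is half of the quadratic one. *)
Hypothesis E_eq : r mu E = 0.
Hypothesis x_neq0 : x != 0.
Hypothesis hyp1 : t mu - 2 * n mu * x != 0.
Hypothesis hyp2 : 1 - D d * x + D s * x ^+ 2 != 0.
Hypothesis hyp3 : 1 - d mu * v0 + 2 * s mu * x * v0 != 0.

(** The product is the derivative of the field along [v]; at [E] the rates and the second coordinate
    vanish, so only one term survives. *)
Let Jmul v : v *m J = row2 (x * (- t mu * v 0 0 + g mu * v 0 1
    - m mu * x * v 0 1 + 2 * n mu * x * v 0 0)) 0.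
Proof.
rewrite -deriveEjacobian; last exact: differentiable_field.
apply/rowP => i; case: (ord2P i) => ->.
  by rewrite derive_field0 E_eq row2E0 row2E1 !mxE /=; ring.
by rewrite derive_field1 E_eq row2E0 row2E1 !mxE /=; ring.
Qed.

(** The second column of [J] is zero, so its characteristic polynomial is [(X - J00) X], and 0 is a
    simple root since [J00 = - x (t - 2 n x)] is non-zero. *)
Lemma transcritical_field : transcritical (fun u => F (row2 a u)) E b.
Proof.
have JE i j : J i j = (('e_i : 'rV_2) *m J) 0 j by rewrite -rowE [RHS]mxE.
have J00 : J 0 0 = - x * (t mu - 2 * n mu * x).
  by rewrite JE Jmul row2E0 !mxE /=; ring.
have Jc1 i : J i 1 = 0 by rewrite JE Jmul row2E1.
have chJ : char_poly J = ('X - (J 0 0)%:P) * 'X.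
  rewrite char_poly_trig; last first.
    apply/is_trig_mxP => i j; case: (ord2P j) => -> //; rewrite ?ltn0//.
  rewrite !big_ord_recl big_ord0 mulr1; congr (('X - (J _ _)%:P) * _).
  by rewrite (_ : lift _ _ = 1) ?Jc1 ?subr0//; exact: val_inj.
have J00_neq0 : J 0 0 != 0 by rewrite J00 mulNr oppr_eq0 mulf_neq0.
split.
- by apply/rowP => i; rewrite fieldE [r _ _]E_eq !mxE mulr0.
- rewrite -/mu -/J chJ mupMr; last by rewrite root_XsubC eq_sym.
  by have := mup_XsubCX 1 0 (0 : R); rewrite subr0 expr1 eqxx.
- exists (J 0 0) => //; rewrite eigenvalue_root_char -/mu -/J chJ.
  by rewrite rootM root_XsubC eqxx.
have Fs_E : (fun y => derive1 (fun u => F (row2 a u) y) b) =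
    (fun y => row2 (y 0 0 * (- D t * y 0 0 + D g * y 0 1 - D m * y 0 0 * y 0 1
          + D n * y 0 0 ^+ 2))
       (y 0 1 * (1 - D d * y 0 0 + D s * y 0 0 ^+ 2 + D p * y 0 1 ^+ 2))).
  by apply/funext => y; have [] := derive_field_second y.
pose v := row2 v0 1.
have c0 := is_derive_coord E v 0.
have c1 := is_derive_coord E v 1.
have Fs_neq0 :
    'D_v (fun y => derive1 (fun u => F (row2 a u) y) b) E 0 1 != 0.
  rewrite Fs_E derive_coord; last first.
    apply: derivable_row2.
      by under eq_fun do rewrite row2E0; exact: ex_derive.
    by under eq_fun do rewrite row2E1; exact: ex_derive.
  under eq_fun do rewrite row2E1.
  rewrite derive_val /GRing.scale /= !row2E0 !row2E1.
  apply: contra hyp2 => /eqP h; apply/eqP; rewrite -[RHS]h; ring.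
exists v, 'e_1; split.
- split; first by apply/eqP => /rowP/(_ 1)/eqP; rewrite row2E1 mxE oner_eq0.
  rewrite Jmul row2E0 row2E1; apply/rowP => i; rewrite !mxE; case: eqP => // _.
  by rewrite /v0; field.
- split; first by apply/eqP => /rowP/(_ 1)/eqP; rewrite !mxE oner_eq0.
  by rewrite -[LHS]rowE; apply/rowP => i; rewrite [LHS]mxE [LHS]mxE Jc1 mxE.
(* The second component of the [mu2]-derivative carries the factor [xi2], zero on the axis. *)
- by rewrite dot_e1 (derive_field_second E).2 row2E1 [E 0 1]row2E1 mul0r.
- by rewrite dot_e1; exact: Fs_neq0.
- rewrite dot_e1.
  have -> : 'D_v (F mu) = fun y => row2 ('D_v (F mu) y 0 0) ('D_v (F mu) y 0 1).
    by apply/funext => y; rewrite row2_eta.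
  have c2 := is_derive_rates0 t g d m n s p mu E v.
  have c3 := is_derive_rates1 t g d m n s p mu E v.
  rewrite derive_coord; last first.
    apply: derivable_row2.
      by under eq_fun do rewrite row2E0 derive_field0; exact: ex_derive.
    by under eq_fun do rewrite row2E1 derive_field1; exact: ex_derive.
  under eq_fun do rewrite row2E1 derive_field1.
  rewrite derive_val /GRing.scale /= !row2E0 !row2E1.
  apply: contra hyp3 => /eqP h; apply/eqP.
  (* Both factors of the second component depend on [xi], and their derivatives contribute equally:
     hence the factor 2. *)
  apply: (@mulfI _ 2%:R); first by rewrite pnatr_eq0.
  rewrite mulr0 -[RHS]h; ring.
Qed.

End Field.
End Transcritical.

(** * Existence of the equilibria [E1] and [E3] *)

Section Branches.
Variable R : realType.
Implicit Types (mu : 'rV[R]_2) (f : 'rV[R]_2 -> R).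

Lemma coord_norm_le mu i : `|mu 0 i| <= `|mu|.
Proof.
by rewrite -[in leRHS](row2_eta mu) norm_row2 le_max; case: (ord2P i) => ->;
  rewrite lexx ?orbT.
Qed.

Lemma lip0_coord i : lip0 (fun mu => mu 0 i).
Proof.
exists 1, setT; split => //; first exact: filterT.
by move=> x y _ _; rewrite mul1r; have := coord_norm_le (x - y) i; rewrite !mxE.
Qed.

Lemma cvg_coord0 i : mu 0 i @[mu --> (0 : 'rV[R]_2)] --> (0 : R).
Proof. by have := lip0_cvg (lip0_coord i); rewrite mxE. Qed.

Lemma cvg_row2 (T : Type) (F : set_system T) (FF : Filter F) (f g : T -> R) :
  f x @[x --> F] --> (0 : R) -> g x @[x --> F] --> (0 : R) ->
  row2 (f x) (g x) @[x --> F] --> (0 : 'rV[R]_2).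
Proof.
move=> f0 g0; apply/cvgr0Pnorm_lt => e e0.
move/cvgr0Pnorm_lt/(_ _ e0): f0; move/cvgr0Pnorm_lt/(_ _ e0): g0.
by apply: filterS2 => x gx fx; rewrite norm_row2 gt_max fx gx.
Qed.

(** A Newton step with the slope frozen at its value [- t 0] at the origin. *)
Lemma axis_branch_exists (t n : 'rV[R]_2 -> R) :
  lip0 t -> lip0 n -> t 0 != 0 ->
  exists e1 : 'rV[R]_2 -> R, solution_branch (axis_rate t n) e1.
Proof.
move=> /lip0_cvg tc /lip0_cvg nc t0.
pose T mu x := x + axis_rate t n mu x / t 0.
have [||e1 e1P] := @parametric_fixpoint R 'rV[R]_2 R T; last first.
- exists e1; apply: solution_branch_iff e1P => mu x; rewrite /T opprD addNKr.
  split => [/eqP|->]; last by rewrite mul0r oppr0.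
  by rewrite oppr_eq0 mulf_eq0 invr_eq0 (negbTE t0) orbF => /eqP.
- rewrite /T /axis_rate.
  have -> : (fun mu => 0 + (mu 0 0 - t mu * 0 + n mu * 0 ^+ 2) / t 0) =
            (fun mu => mu 0 0 / t 0).
    by apply/funext => mu; rewrite expr0n /= !mulr0 subr0 addr0 add0r.
  by rewrite -[X in _ --> X](mul0r (t 0)^-1);
    apply: cvgM (cvg_coord0 0) (cvg_cst _).
(* The secant slope of [T mu] between the two points; it tends to 0. *)
- pose b (z : 'rV[R]_2 * (R * R)) :=
    1 - t z.1 / t 0 + n z.1 * (z.2.1 + z.2.2) / t 0.
  have b0 : b z @[z --> filter_prod (nbhs (0 : 'rV[R]_2)) (nbhs (0 : R * R))]
      --> (0 : R).
    have -> : 0 = 1 - t 0 / t 0 + n 0 * (0 + 0) / t 0 :> R.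
      by rewrite divff// addr0 mulr0 mul0r addr0 subrr.
    have tz := cvg_comp _ _ cvg_fst tc.
    have nz := cvg_comp _ _ cvg_fst nc.
    apply: cvgD.
      apply: cvgB; first exact: cvg_cst.
      by apply: cvgM; [exact: tz|exact: cvg_cst].
    apply: cvgM; last exact: cvg_cst.
    apply: cvgM; first exact: nz.
    apply: cvgD; [apply: cvg_comp cvg_snd cvg_fst|apply: cvg_comp cvg_snd cvg_snd].
  have : \forall z \near filter_prod (nbhs (0 : 'rV[R]_2)) (nbhs (0 : R * R)),
      `|b z| <= 2^-1.
    by move/cvgr0Pnorm_le: b0; apply; lra.
  apply: filterS => -[mu [x y]]; rewrite /b /= => bz.
  have -> : T mu x - T mu y =
      (1 - t mu / t 0 + n mu * (x + y) / t 0) * (x - y).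
    by rewrite /T /axis_rate; field.
  by rewrite normrM ler_wpM2r.
Qed.


(** Again a frozen Newton step: the linear part at the origin has rows [(- t 0, g 0)] and
    [(- d 0, 1)], with determinant [- D], and [T] subtracts its inverse applied to the rates. *)
Lemma planar_branch_exists (t g d m n s p : 'rV[R]_2 -> R) :
  lip0 t -> lip0 g -> lip0 d -> lip0 m -> lip0 n -> lip0 s -> lip0 p ->
  t 0 - g 0 * d 0 != 0 ->
  exists E3 : 'rV[R]_2 -> 'rV[R]_2,
    solution_branch (rates t g d m n s p) E3.
Proof.
move=> /lip0_cvg tc /lip0_cvg gc /lip0_cvg dc /lip0_cvg mc /lip0_cvg nc.
move=> /lip0_cvg sc /lip0_cvg pc D0.
set r := rates t g d m n s p; set D := t 0 - g 0 * d 0.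
pose T mu x := x + row2 ((r mu x 0 0 - g 0 * r mu x 0 1) / D)
                        ((d 0 * r mu x 0 0 - t 0 * r mu x 0 1) / D).
have [||E3 E3P] := @parametric_fixpoint R 'rV[R]_2 'rV[R]_2 T; last first.
- exists E3; apply: solution_branch_iff E3P => mu x; rewrite /T opprD addNKr.
  split => [/eqP|rx]; last first.
    by apply/rowP => i; rewrite rx !mxE; case: eqP => _;
      rewrite !mulr0 subrr mul0r oppr0.
  rewrite oppr_eq0 => /eqP h.
  have := row2E0 ((r mu x 0 0 - g 0 * r mu x 0 1) / D)
    ((d 0 * r mu x 0 0 - t 0 * r mu x 0 1) / D).
  have := row2E1 ((r mu x 0 0 - g 0 * r mu x 0 1) / D)
    ((d 0 * r mu x 0 0 - t 0 * r mu x 0 1) / D).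
  rewrite h [X in X = _ -> _]mxE [X in _ -> X = _ -> _]mxE => /esym/eqP.
  rewrite mulf_eq0 invr_eq0 (negbTE D0) orbF => /eqP h1 /esym/eqP.
  rewrite mulf_eq0 invr_eq0 (negbTE D0) orbF => /eqP h0.
  (* Elimination: inserting this in [d 0 * r0 - t 0 * r1 = 0] leaves [D * r1 = 0]. *)
  have r0 : r mu x 0 0 = g 0 * r mu x 0 1.
    by apply/eqP; rewrite -subr_eq0 h0.
  have : D * r mu x 0 1 = 0 by apply: oppr_inj; rewrite oppr0 -[RHS]h1 r0 /D; ring.
  move/eqP; rewrite mulf_eq0 (negbTE D0) /= => /eqP r1.
  by apply/rowP => i; case: (ord2P i) => ->;
    rewrite [RHS]mxE -/r ?r1// r0 r1 mulr0.
- have -> : (fun mu => T mu 0) = (fun mu =>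
      row2 ((mu 0 0 - g 0 * mu 0 1) / D) ((d 0 * mu 0 0 - t 0 * mu 0 1) / D)).
    apply/funext => mu; rewrite /T add0r /r rates0E rates1E !mxE.
    by rewrite !mulr0 expr0n /= !mulr0 !subr0 !addr0.
  have lin (a b : R) : (a * mu 0 0 - b * mu 0 1) / D
      @[mu --> (0 : 'rV[R]_2)] --> (0 : R).
    have -> : 0 = (a * 0 - b * 0) / D by rewrite !mulr0 subrr mul0r.
    apply: cvgM; last exact: cvg_cst.
    apply: cvgB; apply: cvgM; try exact: cvg_cst; exact: cvg_coord0.
  apply: (@cvg_row2 _ (nbhs (0 : 'rV[R]_2)) (nbhs_filter _)); last exact: lin.
  have -> : (fun mu => (mu 0 0 - g 0 * mu 0 1) / D) =
      (fun mu => (1 * mu 0 0 - g 0 * mu 0 1) / D).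
    by apply/funext => mu; rewrite mul1r.
  exact: lin.
- set F := filter_prod (nbhs (0 : 'rV[R]_2)) (nbhs (0 : 'rV[R]_2 * 'rV[R]_2)).
  have FF : Filter F by apply: filter_prod_filter.
  pose a0 (z : 'rV[R]_2 * ('rV[R]_2 * 'rV[R]_2)) :=
    t 0 - t z.1 - m z.1 * z.2.1 0 1 + n z.1 * (z.2.1 0 0 + z.2.2 0 0).
  pose b0 (z : 'rV[R]_2 * ('rV[R]_2 * 'rV[R]_2)) :=
    g z.1 - g 0 - m z.1 * z.2.2 0 0.
  pose a1 (z : 'rV[R]_2 * ('rV[R]_2 * 'rV[R]_2)) :=
    d 0 - d z.1 + s z.1 * (z.2.1 0 0 + z.2.2 0 0).
  pose b1 (z : 'rV[R]_2 * ('rV[R]_2 * 'rV[R]_2)) :=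
    p z.1 * (z.2.1 0 1 + z.2.2 0 1).
  have z1 f : f mu @[mu --> (0 : 'rV[R]_2)] --> f 0 ->
      f z.1 @[z --> F] --> f 0.
    by move=> fc; exact: cvg_comp _ _ cvg_fst fc.
  have x0 (i : 'I_2) : (z.2.1 : 'rV_2) 0 i @[z --> F] --> (0 : R).
    have h : z.2.1 @[z --> F] --> (0 : 'rV[R]_2) by apply: cvg_comp cvg_snd cvg_fst.
    exact: cvg_comp _ _ h (cvg_coord0 i).
  have y0 (i : 'I_2) : (z.2.2 : 'rV_2) 0 i @[z --> F] --> (0 : R).
    have h : z.2.2 @[z --> F] --> (0 : 'rV[R]_2) by apply: cvg_comp cvg_snd cvg_snd.
    exact: cvg_comp _ _ h (cvg_coord0 i).
  have xy0 f (i : 'I_2) : f mu @[mu --> (0 : 'rV[R]_2)] --> f 0 ->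
      f z.1 * ((z.2.1 : 'rV_2) 0 i + (z.2.2 : 'rV_2) 0 i) @[z --> F] --> (0 : R).
    move=> fc; have -> : 0 = f 0 * (0 + 0) by rewrite addr0 mulr0.
    by apply: cvgM; [exact: z1|exact: cvgD].
  have a0c : a0 z @[z --> F] --> (0 : R).
    have -> : 0 = t 0 - t 0 - m 0 * 0 + 0 by rewrite subrr mulr0 subrr addr0.
    apply: cvgD; last exact: xy0.
    apply: cvgB; last by apply: cvgM; [exact: z1|exact: x0].
    by apply: cvgB; [exact: cvg_cst|exact: z1].
  have b0c : b0 z @[z --> F] --> (0 : R).
    have -> : 0 = g 0 - g 0 - m 0 * 0 by rewrite subrr mulr0 subrr.
    apply: cvgB; last by apply: cvgM; [exact: z1|exact: y0].
    by apply: cvgB; [exact: z1|exact: cvg_cst].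
  have a1c : a1 z @[z --> F] --> (0 : R).
    have -> : 0 = d 0 - d 0 + 0 by rewrite subrr addr0.
    apply: cvgD; last exact: xy0.
    by apply: cvgB; [exact: cvg_cst|exact: z1].
  have b1c : b1 z @[z --> F] --> (0 : R) by exact: xy0.
  (* [K] dominates the row sums [1 + |g 0|] and [|d 0| + |t 0|] of the inverse times [D]; [e] is
     chosen so that [2 e K / |D|] equals 1/2. *)
  pose K := 1 + `|g 0| + `|d 0| + `|t 0|.
  have K0 : 0 < K by rewrite /K -!addrA ltr_pwDl// !addr_ge0.
  pose e := `|D| / (4 * K).
  have e0 : 0 < e by rewrite divr_gt0 ?normr_gt0// mulr_gt0.
  have small (c : 'rV[R]_2 * ('rV[R]_2 * 'rV[R]_2) -> R) :
      c z @[z --> F] --> (0 : R) -> F [set z | `|c z| <= e].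
    by move/cvgr0Pnorm_le; apply.
  have ce := @filterI _ F FF _ _ (@filterI _ F FF _ _ (small _ a0c) (small _ b0c))
    (@filterI _ F FF _ _ (small _ a1c) (small _ b1c)).
  apply: (@filterS _ F FF _ _ _ ce) => -[mu [x y]] /= [[]].
  rewrite /a0 /b0 /a1 /b1 /= => a0e b0e [a1e b1e].
  set dx := x 0 0 - y 0 0; set dy := x 0 1 - y 0 1.
  have dE : x - y = row2 dx dy by rewrite -(row2_eta x) -(row2_eta y) row2B.
  set u := (X in `|X| <= e) in a0e; set v := (X in `|X| <= e) in b0e.
  set u' := (X in `|X| <= e) in a1e; set v' := (X in `|X| <= e) in b1e.
  have -> : T mu x - T mu y =
    row2 ((u * dx + v * dy - g 0 * (u' * dx + v' * dy)) / D)
         ((d 0 * (u * dx + v * dy) - t 0 * (u' * dx + v' * dy)) / D).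
    rewrite /T opprD addrACA dE row2B.
    apply/rowP => i; case: (ord2P i) => ->; rewrite [LHS]mxE ?row2E0 ?row2E1.
      by rewrite /dx /dy /u /v /u' /v' /D; field.
    by rewrite /dx /dy /u /v /u' /v' /D; field.
  rewrite dE !norm_row2; set M := Num.max `|dx| `|dy|.
  have M0 : 0 <= M by rewrite le_max normr_ge0.
  have dxM : `|dx| <= M by rewrite le_max lexx.
  have dyM : `|dy| <= M by rewrite le_max lexx orbT.
  have comb c c' : `|c| <= e -> `|c'| <= e -> `|c * dx + c' * dy| <= 2 * e * M.
    move=> c_e c'_e; apply: le_trans (ler_normD _ _) _; rewrite !normrM.
    have -> : 2 * e * M = e * M + e * M by ring.
    by apply: lerD; apply: ler_pM.
  have fin c c' U V : `|U| <= 2 * e * M -> `|V| <= 2 * e * M ->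
      `|c| + `|c'| <= K -> `|(c * U - c' * V) / D| <= 2^-1 * M.
    move=> Ue Ve cK; rewrite normrM normfV ler_pdivrMr ?normr_gt0//.
    apply: le_trans (ler_normB _ _) _; rewrite !normrM.
    have -> : 2^-1 * M * `|D| = K * (2 * e * M).
      by rewrite /e; field; rewrite gt_eqF.
    have eM : 0 <= 2 * e * M 
      by apply: mulr_ge0 => //; apply: mulr_ge0 => //; exact: ltW.
    apply: le_trans (ler_wpM2r eM cK); rewrite mulrDl.
    by apply: lerD; apply: ler_wpM2l.
  have Uc := comb _ _ a0e b0e; have Vc := comb _ _ a1e b1e.
  rewrite ge_max; apply/andP; split.
    rewrite -[u * dx + v * dy]mul1r; apply: fin => //.
    by rewrite normr1 /K -addrA lerDl addr_ge0.
  by apply: fin => //; rewrite /K -addrA [1 + _ + _]addrC lerDl addr_ge0.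
Qed.

End Branches.

(** * Lipschitz bound and first-order expansion of [E1] *)

Lemma qlip0_near (R : realType) (V : normedModType R) (f g : V -> R) :
  (\forall x \near (0 : V), f x = g x) -> qlip0 f -> qlip0 g.
Proof.
move=> fg [C [A [C0 A0 fC]]]; exists C, (A `&` [set x | f x = g x]).
split; [by []|exact: filterI|] => x y [Ax /= <-] [Ay /= <-]; exact: fC.
Qed.

Lemma qlip0_lip0 (R : realType) (V : normedModType R) (f : V -> R) :
  qlip0 f -> lip0 f.
Proof.
move=> [C [A [C0 A0 fC]]]; exists (C * 2), (A `&` [set x | `|x| < 1]).
split; [exact: mulr_ge0|exact: filterI (near_norm_lt V ltr01)|].
move=> x y [Ax /= x1] [Ay /= y1]; apply: le_trans (fC _ _ Ax Ay) _.
by apply: ler_wpM2r => //; apply: ler_wpM2l => //; lra.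
Qed.

Section AxisBranch.
Variables (R : realType) (t n : 'rV[R]_2 -> R) (e1 : 'rV[R]_2 -> R).
Hypotheses (tl : lip0 t) (nl : lip0 n) (t0 : t 0 != 0).
Hypothesis e1P : solution_branch (axis_rate t n) e1.

(** Subtracting the equations at [x] and [y] leaves [e1 x - e1 y] times a factor of size at least
    [|t 0| / 2], equal to terms bounded by [|x - y|]. *)
Lemma axis_branch_lip0 : lip0 e1.
Proof.
have [e1c e1e _] := e1P.
have tc := lip0_cvg tl; have nb := lip0_bounded nl.
have [Kt [A [Kt0 A0 tK]]] := tl; have [Kn [B [Kn0 B0 nK]]] := nl.
have q : 0 < `|t 0| / 4 by rewrite divr_gt0 ?normr_gt0.
pose Bn := `|n 0| + 1; have Bn0 : 0 < Bn by rewrite ltr_wpDl.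
have tq : \forall mu \near (0 : 'rV[R]_2), `|t 0 - t mu| <= `|t 0| / 4.
  by move/cvgrPdist_le: tc; apply.
(* Two values of [e1] times [n] then cost at most [|t 0| / 4], and replacing [t 0] by [t x] costs
   another quarter. *)
have e1q : \forall mu \near (0 : 'rV[R]_2), `|e1 mu| <= `|t 0| / 8 / Bn.
  by move/cvgr0Pnorm_le: e1c; apply; rewrite !divr_gt0 ?normr_gt0.
have e11 : \forall mu \near (0 : 'rV[R]_2), `|e1 mu| <= 1.
  by move/cvgr0Pnorm_le: e1c; apply.
exists (2 / `|t 0| * (1 + Kt + Kn)), ((A `&` B) `&`
  ([set mu | axis_rate t n mu (e1 mu) = 0 /\ `|n mu| <= Bn] `&`
   [set mu | `|t 0 - t mu| <= `|t 0| / 4] `&`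
   [set mu | `|e1 mu| <= `|t 0| / 8 / Bn /\ `|e1 mu| <= 1])).
split.
- by rewrite mulr_ge0 ?divr_ge0// !addr_ge0.
- exact: filterI (filterI A0 B0)
    (filterI (filterI (filterI e1e nb) tq) (filterI e1q e11)).
move=> x y [[Ax Bx] [[[ex nx] tx] [qx _]]] [[Ay By] [[[ey _] _] [qy y1]]] /=.
have eqn : (e1 x - e1 y) * (t x - n x * (e1 x + e1 y)) =
    (x 0 0 - y 0 0) - (t x - t y) * e1 y + (n x - n y) * e1 y ^+ 2.
  move: ex ey; rewrite /axis_rate => ex ey.
  apply/eqP; rewrite -subr_eq0; apply/eqP.
  transitivity (- (x 0 0 - t x * e1 x + n x * e1 x ^+ 2) +
    (y 0 0 - t y * e1 y + n y * e1 y ^+ 2)); first by ring.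
  by rewrite ex ey oppr0 addr0.
have low : `|t 0| / 2 <= `|t x - n x * (e1 x + e1 y)|.
  have ns : `|n x * (e1 x + e1 y)| <= `|t 0| / 4.
    rewrite normrM.
    have -> : `|t 0| / 4 = Bn * (`|t 0| / 8 / Bn + `|t 0| / 8 / Bn).
      by field; rewrite gt_eqF.
    apply: ler_pM => //; apply: le_trans (ler_normD _ _) _; exact: lerD.
  have := ler_normD (t x - n x * (e1 x + e1 y)) (t 0 - t x + n x * (e1 x + e1 y)).
  have := ler_normD (t 0 - t x) (n x * (e1 x + e1 y)).
  have -> : t x - n x * (e1 x + e1 y) + (t 0 - t x + n x * (e1 x + e1 y)) = t 0.
    by ring.
  have tx' : `|t 0 - t x| <= `|t 0| / 4 := tx.
  lra.
have up : `|(e1 x - e1 y) * (t x - n x * (e1 x + e1 y))| <=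
    (1 + Kt + Kn) * `|x - y|.
  have h1 : `|x 0 0 - y 0 0| <= `|x - y|.
    by have := coord_norm_le (x - y) 0; rewrite !mxE.
  have h2 : `|(t x - t y) * e1 y| <= Kt * `|x - y|.
    by rewrite normrM -[leRHS]mulr1; apply: ler_pM => //; exact: tK.
  have h3 : `|(n x - n y) * e1 y ^+ 2| <= Kn * `|x - y|.
    rewrite normrM -[leRHS]mulr1; apply: ler_pM => //; first exact: nK.
    by rewrite normrX exprn_ile1.
  rewrite eqn; apply: le_trans (ler_normD _ _) _.
  have -> : (1 + Kt + Kn) * `|x - y| =
    `|x - y| + Kt * `|x - y| + Kn * `|x - y| by ring.
  apply: lerD => //.
  by apply: le_trans (ler_normB _ _) _; exact: lerD.
have tn : 0 < `|t 0| by rewrite normr_gt0.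
have -> : 2 / `|t 0| * (1 + Kt + Kn) * `|x - y| =
    (1 + Kt + Kn) * `|x - y| / (`|t 0| / 2) by field; rewrite gt_eqF.
rewrite ler_pdivlMr ?divr_gt0//; apply: le_trans up.
by rewrite normrM ler_wpM2l.
Qed.

(** This factored form yields the expansion of [e1] and, on [T1], its sign. *)
Lemma axis_branch_near_eq : \forall mu \near (0 : 'rV[R]_2),
  (t mu - n mu * e1 mu) * e1 mu = mu 0 0.
Proof.
have [_ e1e _] := e1P; apply: filterS e1e => mu; rewrite /axis_rate => e.
apply/eqP; rewrite -subr_eq0 -oppr_eq0; apply/eqP; rewrite -[RHS]e; ring.
Qed.

Lemma axis_branch_expansion : qlip0 (fun mu => e1 mu - mu 0 0 / t 0).
Proof.
have e1l := axis_branch_lip0; have e10 := solution_branch0 e1P.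
(* Near 0 the remainder is a sum of products of Lipschitz functions vanishing at 0. *)
apply: (@qlip0_near _ _ (fun mu => (t 0)^-1 * ((t 0 - t mu) * e1 mu) +
  (t 0)^-1 * ((n mu * e1 mu) * e1 mu))).
  by apply: filterS axis_branch_near_eq => mu <-; field.
apply: qlip0D; apply: qlip0Z; apply: qlip0M => //.
- by apply: lip0D; [exact: lip0_cst|exact: lip0N].
- by rewrite subrr.
- exact: lip0M.
- by rewrite e10 mulr0.
Qed.

End AxisBranch.

(** * The curve as a graph over [mu1] *)

(** On a small ball [rho] is 1/2-Lipschitz, so [y = a s + rho (s, y)] is a contraction in [y] with
    fixed point [h s]. The fixed-point equation makes [h] Lipschitz, and then [rho (s, h s)] is
    quadratic in [s]. *)
Lemma graph_branch (R : realType) (a : R) (rho : 'rV[R]_2 -> R) :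
  qlip0 rho -> rho 0 = 0 ->
  exists h : R -> R,
    [/\ \forall s \near (0 : R), {for s, continuous h},
        (fun s : R => h s - a * s) =O_ (nbhs (0 : R)) (fun s : R => s ^+ 2)
      & \forall mu \near (0 : 'rV[R]_2),
          rho mu + a * mu 0 0 = mu 0 1 <-> mu 0 1 = h (mu 0 0)].
Proof.
move=> rhoq rho0; have [C [A [C0 A0 rhoC]]] := rhoq.
have [r0 /= r0p r0A] := (nbhs_ballP _ _).1 A0.
(* This ensures [C (r + r) <= 1/2]; the added 1 covers [C = 0]. *)
pose r := Num.min r0 (2 * (2 * C + 1))^-1.
have rp : 0 < r.
  by rewrite lt_min r0p invr_gt0 mulr_gt0// ltr_wpDl// mulr_ge0.
have Cr : C * (r + r) <= 2^-1.
  have C1 : 0 < 2 * C + 1 by rewrite ltr_wpDl// mulr_ge0.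
  have : r <= (2 * (2 * C + 1))^-1 by rewrite ge_min lexx orbT.
  rewrite -(ler_pM2l (_ : 0 < 2 * C + 1)) // invfM mulrCA divff ?gt_eqF// mulr1.
  by nra.
have inA s y : `|s| < r -> `|y| < r -> A (row2 s y).
  move=> sr yr; apply: r0A; rewrite -ball_normE /ball_ /= sub0r normrN norm_row2.
  have rr0 : r <= r0 by rewrite ge_min lexx.
  by rewrite gt_max !(lt_le_trans _ rr0).
have rhoL s y s' y' : `|s| < r -> `|y| < r -> `|s'| < r -> `|y'| < r ->
    `|rho (row2 s y) - rho (row2 s' y')| <=
      2^-1 * Num.max `|s - s'| `|y - y'|.
  move=> sr yr sr' yr'; apply: le_trans (rhoC _ _ (inA _ _ sr yr) (inA _ _ sr' yr')) _.
  rewrite row2B (norm_row2 (s - s')); apply: ler_wpM2r; first by rewrite le_max normr_ge0.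
  apply: le_trans Cr; apply: ler_wpM2l => //.
  by apply: lerD; rewrite norm_row2 ge_max !ltW.
pose T s y := a * s + rho (row2 s y).
have [||h hP] := @parametric_fixpoint R R R T.
- exists ([set s | `|s| < r], [set p : R * R | `|p.1| < r /\ `|p.2| < r]).
    split; first exact: (near_norm_lt R rp).
    exists ([set s | `|s| < r], [set s | `|s| < r]); last by move=> [].
    by split; exact: (near_norm_lt R rp).
  move=> [s [x y]] /= [sr [xr yr]].
  have -> : T s x - T s y = rho (row2 s x) - rho (row2 s y) by rewrite /T; ring.
  by apply: le_trans (rhoL _ _ _ _ sr xr sr yr) _; rewrite subrr normr0 max_r.
- have row0 : row2 s 0 @[s --> (0 : R)] --> (0 : 'rV[R]_2).
    by apply: (@cvg_row2 _ _ (nbhs (0 : R))); [exact: cvg_id|exact: cvg_cst].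
  suff : T s 0 @[s --> (0 : R)] --> a * 0 + rho 0.
    by rewrite rho0 mulr0 addr0.
  apply: cvgD; first by apply: cvgM; [exact: cvg_cst|exact: cvg_id].
  exact: cvg_comp _ _ row0 (lip0_cvg (qlip0_lip0 rhoq)).
have [hc he hu] := hP; have h0 := solution_branch0 hP.
pose good s := [/\ `|s| < r, `|h s| < r & h s = T s (h s)].
have near_good : \forall s \near (0 : R), good s.
  have hr : \forall s \near (0 : R), `|h s| < r.
    by move/cvgr0Pnorm_lt: hc; apply.
  apply: filterS3 (near_norm_lt R rp) hr he => s sr hsr /eqP.
  by rewrite subr_eq0 => /eqP.
(* With the maximum bounded by the sum, half of [|h s - h s'|] is absorbed on the left, which
   doubles [|a| + 1/2]. *)
have hL s s' : good s -> good s' -> `|h s - h s'| <= (2 * `|a| + 1) * `|s - s'|.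
  move=> [sr hr hs] [sr' hr' hs'].
  have L := rhoL _ _ _ _ sr hr sr' hr'.
  have : `|h s - h s'| <= `|a| * `|s - s'| +
      2^-1 * (`|s - s'| + `|h s - h s'|).
    have hd : h s - h s' =
        a * (s - s') + (rho (row2 s (h s)) - rho (row2 s' (h s'))).
      by rewrite {1}hs {1}hs' /T; ring.
    rewrite {1}hd.
    apply: le_trans (ler_normD _ _) _; rewrite normrM lerD//.
    apply: le_trans L _; apply: ler_wpM2l => //.
    by have := normr_ge0 (s - s'); have := normr_ge0 (h s - h s');
      rewrite ge_max => p q; apply/andP; split; lra.
  lra.
have good0 : good 0 := nbhs_singleton near_good.
exists h; split.
(* Continuity at [s] needs good points all around [s], hence the interior. *)
- have : \forall s \near (0 : R), \forall s' \near s, good s'.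
    by move: near_good; rewrite -nbhs_nearE; exact: nbhs_interior.
  apply: filterS => s gs; have gs0 := nbhs_singleton gs.
  apply/cvgrPdist_le => e e0.
  have K0 : 0 < 2 * `|a| + 1 by rewrite ltr_wpDl// mulr_ge0.
  have cl : \forall s' \near s, `|s - s'| <= e / (2 * `|a| + 1).
    by have /cvgrPdist_le := @cvg_id _ (nbhs s); apply; rewrite divr_gt0.
  apply: filterS2 gs cl => s' gs'; rewrite ler_pdivlMr// mulrC.
  exact: le_trans (hL _ _ gs0 gs').
(* From [|(s, h s)| <= (2 |a| + 2) |s|]; the last 1 keeps the constant positive. *)
- apply/eqO_exP; exists (C * (2 * `|a| + 2) ^+ 2 + 1).
    by rewrite ltr_wpDl// mulr_ge0// exprn_ge0// addr_ge0// mulr_ge0.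
  apply: filterS near_good => s gs; have [sr hr hs] := gs.
  have hK : `|h s| <= (2 * `|a| + 1) * `|s|.
    by have := hL _ _ gs good0; rewrite h0 !subr0.
  have -> : h s - a * s = rho (row2 s (h s)) - rho 0.
    by rewrite {1}hs /T rho0; ring.
  apply: le_trans (rhoC _ _ (inA _ _ sr hr) (nbhs_singleton A0)) _.
  rewrite !subr0 normr0 addr0 -mulrA -expr2.
  have nK : `|row2 s (h s)| <= (2 * `|a| + 2) * `|s|.
    rewrite norm_row2 ge_max; have := normr_ge0 a; have := normr_ge0 s => s0 a0.
    by apply/andP; split; nra.
  rewrite normrX mulrDl -[leLHS]addr0; apply: lerD; last by rewrite mulr_ge0// exprn_ge0.
  rewrite -mulrA -exprMn; apply: ler_wpM2l => //.
  by rewrite lerXn2r// nnegrE// mulr_ge0// addr_ge0// mulr_ge0.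
- have [[U W] /= [U0 W0] UW] := hu.
  have c0 := @cvg_coord0 R 0; have c1 := @cvg_coord0 R 1.
  have ng : nbhs 0 [set mu : 'rV[R]_2 | good (mu 0 0)] := c0 _ near_good.
  have nU : nbhs 0 [set mu : 'rV[R]_2 | U (mu 0 0)] := c0 _ U0.
  have nW : nbhs 0 [set mu : 'rV[R]_2 | W (mu 0 1)] := c1 _ W0.
  apply: filterS3 ng nU nW => mu [_ _ hs] Umu Wmu; split => [e|e].
    apply: (UW (mu 0 0, mu 0 1)) => //=.
    by rewrite /T row2_eta -e; ring.
  by rewrite [RHS]e hs /T -e row2_eta addrC.
Qed.

(** * Non-degeneracy for small parameters *)

Lemma smooth_near_derivable (R : realType) (f : 'rV[R]_2 -> R) (i : 'I_2) :
  smooth_near 0 f -> \forall mu \near (0 : 'rV[R]_2), derivable f mu 'e_i.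
Proof. by apply: filterS => mu /(_ 1%N)[_ /(_ i)[]]. Qed.

Lemma smooth_near_derive_cvg (R : realType) (f : 'rV[R]_2 -> R) (i : 'I_2) :
  smooth_near 0 f -> 'D_('e_i) f mu @[mu --> (0 : 'rV[R]_2)] --> 'D_('e_i) f 0.
Proof. by move=> /nbhs_singleton/(_ 1%N)[_ /(_ i)[_ []]]. Qed.

(** The four quantities tend to [t0], 1, [1 - d0 g0 / t0] and 1. Here [d'] and [s'] stand for the
    [mu2]-derivatives of [delta] and [S], and [x] for [e1]. *)
Lemma near_nondegenerate (R : realType) (T : Type) (F : set_system T)
    (FF : Filter F) (t g d m n s d' s' x : T -> R) (t0 g0 d0 m0 n0 s0 d1 s1 : R) :
  t0 != 0 -> t0 - g0 * d0 != 0 ->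
  t z @[z --> F] --> t0 -> g z @[z --> F] --> g0 -> d z @[z --> F] --> d0 ->
  m z @[z --> F] --> m0 -> n z @[z --> F] --> n0 -> s z @[z --> F] --> s0 ->
  d' z @[z --> F] --> d1 -> s' z @[z --> F] --> s1 -> x z @[z --> F] --> 0 ->
  \forall z \near F,
    let v := (g z - m z * x z) / (t z - 2 * n z * x z) in
    [/\ t z - 2 * n z * x z != 0, 1 - d' z * x z + s' z * x z ^+ 2 != 0,
        1 - d z * v + 2 * s z * x z * v != 0
      & 0 < (t z - n z * x z) / t0].
Proof.
move=> t0_neq0 nondeg tc gc dc mc nc sc ddc dsc xc.
have cc (c : R) : (fun=> c) @ F --> c by exact: cvg_cst.
pose v z := (g z - m z * x z) / (t z - 2 * n z * x z).
have nx : n z * x z @[z --> F] --> n0 * 0 by apply: cvgM; [exact: nc|exact: xc].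
have mx : m z * x z @[z --> F] --> m0 * 0 by apply: cvgM; [exact: mc|exact: xc].
have den : t z - 2 * n z * x z @[z --> F] --> t0.
  suff : t z - 2 * n z * x z @[z --> F] --> t0 - 2 * n0 * 0.
    by rewrite mulr0 subr0.
  apply: cvgB; first exact: tc.
  by apply: cvgM; [apply: cvgM; [exact: cc|exact: nc]|exact: xc].
have vc : v z @[z --> F] --> g0 / t0.
  suff : v z @[z --> F] --> (g0 - m0 * 0) / t0 by rewrite mulr0 subr0.
  apply: cvgM; last exact: cvgV t0_neq0 den.
  by apply: cvgB; [exact: gc|exact: mx].
have hyp1 : \forall z \near F, t z - 2 * n z * x z != 0.
  exact: cvgr_neq0 den t0_neq0.
have hyp2 : \forall z \near F, 1 - d' z * x z + s' z * x z ^+ 2 != 0.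
  apply: (@cvgr_neq0 _ _ _ F _ _ (1 : R)); last exact: oner_neq0.
  suff : 1 - d' z * x z + s' z * x z ^+ 2 @[z --> F] -->
      1 - d1 * 0 + s1 * (0 * 0) by rewrite !mulr0 subr0 addr0.
  apply: cvgD.
    by apply: cvgB; [exact: cc|apply: cvgM; [exact: ddc|exact: xc]].
  by apply: cvgM; [exact: dsc|apply: cvgM; exact: xc].
have hyp3 : \forall z \near F, 1 - d z * v z + 2 * s z * x z * v z != 0.
  apply: (@cvgr_neq0 _ _ _ F _ _ (1 - d0 * (g0 / t0))).
    suff : 1 - d z * v z + 2 * s z * x z * v z @[z --> F] -->
        1 - d0 * (g0 / t0) + 2 * s0 * 0 * (g0 / t0).
      by rewrite mulr0 mul0r addr0.
    apply: cvgD.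
      by apply: cvgB; [exact: cc|apply: cvgM; [exact: dc|exact: vc]].
    apply: cvgM; last exact: vc.
    by apply: cvgM; [apply: cvgM; [exact: cc|exact: sc]|exact: xc].
  (* Multiplied by [t0], the limit becomes [t0 - g0 d0]. *)
  apply: contra nondeg => /eqP h; apply/eqP.
  by rewrite -[RHS](mul0r t0) -h; field.
have pos : \forall z \near F, 0 < (t z - n z * x z) / t0.
  have lim1 : (t z - n z * x z) / t0 @[z --> F] --> (1 : R).
    suff : (t z - n z * x z) / t0 @[z --> F] --> (t0 - n0 * 0) / t0.
      by rewrite mulr0 subr0 divff.
    by apply: cvgM; [apply: cvgB; [exact: tc|exact: nx]|exact: cc].
  by move/cvgr_gt: lim1; apply; exact: ltr01.
have hyps := @filterI _ F FF _ _ (@filterI _ F FF _ _ hyp1 hyp2)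
  (@filterI _ F FF _ _ hyp3 pos).
by apply: (@filterS _ F FF _ _ _ hyps) => z [[? ?] [? ?]]; split.
Qed.

(** * The condition defining [T1] in terms of [E1] *)

Section Curve.
Variables (R : realType) (t g d m n s p : 'rV[R]_2 -> R).
Variables (e1 : 'rV[R]_2 -> R) (E3 : 'rV[R]_2 -> 'rV[R]_2).
Hypothesis e1P : solution_branch (axis_rate t n) e1.
Hypothesis E3P : solution_branch (rates t g d m n s p) E3.

(** When the second coordinate vanishes, the first rate reduces to [axis_rate], and uniqueness of
    [e1] identifies the first coordinate. *)
Lemma planar_branch_on_axis : \forall mu \near (0 : 'rV[R]_2),
  E3 mu 0 1 = 0 -> E3 mu = row2 (e1 mu) 0.
Proof.
have [E3c E3e _] := E3P.
have xc : E3 mu 0 0 @[mu --> (0 : 'rV[R]_2)] --> (0 : R).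
  exact: cvg_comp _ _ E3c (@cvg_coord0 R 0).
apply: filterS2 E3e (solution_branch_unique e1P xc) => mu re xe y0.
rewrite -[LHS]row2_eta y0 xe// -(row2E0 (axis_rate t n mu (E3 mu 0 0)) 0).
have /rowP/(_ 0) := re; rewrite rates0E y0 [RHS]mxE row2E0 => <-.
by rewrite /axis_rate; ring.
Qed.

(** The right side says that the second rate vanishes at [(e1 mu, 0)]. Conversely this point then
    solves the planar system and equals [E3 mu] by uniqueness. *)
Lemma planar_branch_axis_iff : \forall mu \near (0 : 'rV[R]_2),
  E3 mu 0 1 = 0 <-> d mu * e1 mu - s mu * e1 mu * e1 mu = mu 0 1.
Proof.
have [e1c e1e _] := e1P; have [_ E3e _] := E3P.
have fc : row2 (e1 mu) 0 @[mu --> (0 : 'rV[R]_2)] --> (0 : 'rV[R]_2).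
  by apply: (@cvg_row2 _ _ (nbhs (0 : 'rV[R]_2))) => //; exact: cvg_cst.
have E3u := solution_branch_unique E3P fc.
apply: filterS2 (filterI planar_branch_on_axis E3e) (filterI e1e E3u).
move=> mu [on_axis re] [e1_eq E3_eq]; split => [y0|h].
  have /rowP/(_ 1) := re; rewrite rates1E on_axis// row2E0 row2E1 [RHS]mxE => h.
  by apply/eqP; rewrite -subr_eq0 -oppr_eq0; apply/eqP; rewrite -[RHS]h; ring.
rewrite -E3_eq ?row2E1//; apply/rowP => i; case: (ord2P i) => ->.
  rewrite rates0E row2E0 row2E1 [RHS]mxE -[RHS]e1_eq /axis_rate; ring.
by rewrite rates1E row2E0 row2E1 [RHS]mxE -h; ring.
Qed.

End Curve.

(** * Transcritical bifurcation along [T1] *)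

Theorem theorem2p8 (R : realType)
    (theta gamma delta M N S P : 'rV[R]_2 -> R)
    (theta_smooth : smooth_near 0 theta) (gamma_smooth : smooth_near 0 gamma)
    (delta_smooth : smooth_near 0 delta) (M_smooth : smooth_near 0 M)
    (N_smooth : smooth_near 0 N) (S_smooth : smooth_near 0 S)
    (P_smooth : smooth_near 0 P)
    (gamma_lt0 : gamma 0 < 0)
    (theta_delta : theta 0 * delta 0 != 0)
    (nondeg : theta 0 - gamma 0 * delta 0 != 0) :
  [/\ exists e1 : 'rV[R]_2 -> R, solution_branch (axis_rate theta N) e1,
      exists E3 : 'rV[R]_2 -> 'rV[R]_2,
        solution_branch (rates theta gamma delta M N S P) E3
    & forall (e1 : 'rV[R]_2 -> R) (E3 : 'rV[R]_2 -> 'rV[R]_2),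
        solution_branch (axis_rate theta N) e1 ->
        solution_branch (rates theta gamma delta M N S P) E3 ->
        (exists h : R -> R,
          [/\ \forall s \near (0 : R), {for s, continuous h},
              (fun s : R => h s - delta 0 / theta 0 * s)
                =O_ (nbhs (0 : R)) (fun s : R => s ^+ 2)
            & \forall mu \near (0 : 'rV[R]_2),
                T1 (theta 0) E3 mu <->
                mu 0 1 = h (mu 0 0) /\ 0 < mu 0 0 / theta 0]) /\
        \forall mu \near (0 : 'rV[R]_2), T1 (theta 0) E3 mu ->
          [/\ E3 mu = row2 (e1 mu) 0,
              0 < e1 mu
            & transcritical
                (fun s : R =>
                   field theta gamma delta M N S P (row2 (mu 0 0) s))
                (E3 mu) (mu 0 1)]].
Proof.
have tl := smooth_near_lip0 theta_smooth; have gl := smooth_near_lip0 gamma_smooth.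
have dl := smooth_near_lip0 delta_smooth; have ml := smooth_near_lip0 M_smooth.
have nl := smooth_near_lip0 N_smooth; have sl := smooth_near_lip0 S_smooth.
have pl := smooth_near_lip0 P_smooth.
have t0 : theta 0 != 0 by apply: contraNneq theta_delta => ->; rewrite mul0r.
split; [exact: axis_branch_exists|exact: planar_branch_exists|].
move=> e1 E3 e1P E3P.
have e1l := axis_branch_lip0 tl nl t0 e1P; have e10 := solution_branch0 e1P.
have on_axis := planar_branch_on_axis e1P E3P.
split.
  (* What remains of [delta e1 - S e1^2] after removing its linear part [delta(0)/theta(0) mu1]. *)
  pose rho mu := delta 0 * (e1 mu - mu 0 0 / theta 0) +
    ((delta mu - delta 0) * e1 mu + (- (S mu * e1 mu)) * e1 mu).
  have rhoq : qlip0 rho.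
    apply: qlip0D; first by apply: qlip0Z; exact: axis_branch_expansion tl nl t0 e1P.
    apply: qlip0D; apply: qlip0M => //; last by rewrite e10 mulr0 oppr0.
    - by apply: lip0D => //; exact: lip0_cst.
    - by rewrite subrr.
    - by apply: lip0N; exact: lip0M.
  have rho0 : rho 0 = 0 by rewrite /rho e10 mxE; ring.
  have [h [hc hO hP]] := graph_branch (delta 0 / theta 0) rhoq rho0.
  exists h; split => //.
  apply: filterS2 hP (planar_branch_axis_iff e1P E3P) => mu hmu Emu.
  have -> : T1 (theta 0) E3 mu <-> E3 mu 0 1 = 0 /\ 0 < mu 0 0 / theta 0.
    by rewrite /T1 /=; split => -[].
  suff rhoE : rho mu + delta 0 / theta 0 * mu 0 0 =
      delta mu * e1 mu - S mu * e1 mu * e1 mu by rewrite Emu -rhoE hmu.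
  by rewrite /rho; field.
have [e1c _ _] := e1P.
have tc := lip0_cvg tl; have gc := lip0_cvg gl; have dc := lip0_cvg dl.
have mc := lip0_cvg ml; have nc := lip0_cvg nl; have sc := lip0_cvg sl.
have ddc := smooth_near_derive_cvg (i := 1) delta_smooth.
have dsc := smooth_near_derive_cvg (i := 1) S_smooth.
have nondegenerate := near_nondegenerate (nbhs_filter (0 : 'rV[R]_2))
  t0 nondeg tc gc dc mc nc sc ddc dsc e1c.
have [_ E3e _] := E3P.
have dn f : smooth_near 0 f ->
    \forall mu \near (0 : 'rV[R]_2), derivable f mu 'e_1.
  exact: smooth_near_derivable.
have ders_tgd : \forall mu \near (0 : 'rV[R]_2), [/\ derivable theta mu 'e_1,
    derivable gamma mu 'e_1 & derivable delta mu 'e_1].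
  apply: (@filterS3 _ _ (nbhs_filter (0 : 'rV[R]_2)) _ _ _ _ _
    (dn _ theta_smooth) (dn _ gamma_smooth) (dn _ delta_smooth)).
  by move=> mu dt dg dd; exact: And3.
have ders_MNS : \forall mu \near (0 : 'rV[R]_2), [/\ derivable M mu 'e_1,
    derivable N mu 'e_1 & derivable S mu 'e_1].
  apply: (@filterS3 _ _ (nbhs_filter (0 : 'rV[R]_2)) _ _ _ _ _
    (dn _ M_smooth) (dn _ N_smooth) (dn _ S_smooth)).
  by move=> mu dM dN dS; exact: And3.
have ders : \forall mu \near (0 : 'rV[R]_2),
    [/\ derivable theta mu 'e_1, derivable gamma mu 'e_1, derivable delta mu 'e_1
      & [/\ derivable M mu 'e_1, derivable N mu 'e_1, derivable S mu 'e_1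
      & derivable P mu 'e_1]].
  apply: (@filterS3 _ _ (nbhs_filter (0 : 'rV[R]_2)) _ _ _ _ _
    ders_tgd ders_MNS (dn _ P_smooth)).
  move=> mu [dt dg dd] [dM dN dS] dP.
  exact: And4 dt dg dd (And4 dM dN dS dP).
have FF := nbhs_filter (0 : 'rV[R]_2).
have all := @filterI _ _ FF _ _
  (@filterI _ _ FF _ _ nondegenerate (@filterI _ _ FF _ _ on_axis E3e))
  (@filterI _ _ FF _ _ ders (axis_branch_near_eq e1P)).
apply: (@filterS _ _ FF _ _ _ all).
move=> mu [[[h1 h2 h3 h4] [axis re]] [der prod]] [mu0 y0].
(* Dividing [(theta - N e1) e1 = mu1] by [theta(0)] leaves a positive right side and a positive
   factor in front of [e1]. *)
have e1_gt0 : 0 < e1 mu.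
  by move: mu0; rewrite -prod mulrAC pmulr_rgt0.
split => //; first exact: axis.
have muE := row2_eta mu.
have e1_neq0 : e1 mu != 0 by rewrite gt_eqF.
rewrite axis//; apply: transcritical_field; rewrite ?muE//.
by rewrite -axis.
Qed.
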